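(* Let $\big((A\oplus A^*,\cdot_d,\mathcal B_d),(A,\cdot_A),(A^*,\cdot_{A^*})\big)$ be a double construction of Frobenius commutative algebra, and let $(A,\cdot_A,\Delta)$ be the corresponding commutative and cocommutative infinitesimal bialgebra, where $\Delta:A\to A\otimes A$ is the linear dual of $\cdot_{A^*}$. Let $P,Q:A\to A$ be linear maps. Then the following statements are equivalent. (a) $\big((A\oplus A^*,\cdot_d,P+Q^*,\mathcal B_d),(A,\cdot_A,P),(A^*,\cdot_{A^*},Q^* )\big)$ is a double construction of averaging Frobenius commutative algebra. (b) $(A,\cdot_A,P,Q)$ and $(A^*,\cdot_{A^*},Q^*,P^* )$ are admissible averaging commutative algebras; that is, for all $x,y\in A$ and $a^*,b^*\in A^*$, $$P(x)\cdot_A P(y)=P(P(x)\cdot_A y),\qquad P(x)\cdot_A Q(y)=Q(P(x)\cdot_A y)=Q(x\cdot_A Q(y)),$$ $$Q^*(a^* )\cdot_{A^*}Q^*(b^* )=Q^*(Q^*(a^* )\cdot_{A^*}b^* ),$$ $$Q^*(a^* )\cdot_{A^*}P^*(b^* )=P^*(Q^*(a^* )\cdot_{A^*}b^* )=P^*(a^*\cdot_{A^*}P^*(b^* )).$$ (c) $(A,\cdot_A,\Delta,P,Q)$ is an averaging commutative and cocommutative infinitesimal bialgebra; that is, $(A,\cdot_A,P,Q)$ is an admissible averaging commutative algebra and for all $x\in A$, $$(Q\otimes Q)\Delta(x)=(Q\otimes\mathrm{id})\Delta(Q(x)),$$ $$(Q\otimes P)\Delta(x)=(Q\otimes\mathrm{id})\Delta(P(x))=(\mathrm{id}\otimes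 P)\Delta(P(x)).$$
   Context: All vector spaces and algebras are finite-dimensional over an algebraically closed field $\mathbb K$ of characteristic zero; ''commutative algebra'' means commutative associative (not necessarily unital) algebra. For a linear map $\beta:V\to V$, $\beta^*:V^*\to V^*$ is the transpose, $\langle\beta^*(u^* ),v\rangle=\langle u^*,\beta(v)\rangle$. For $\phi_1:V_1\to V_1$, $\phi_2:V_2\to V_2$, $\phi_1+\phi_2:V_1\oplus V_2\to V_1\oplus V_2$ is $v_1+v_2\mapsto\phi_1(v_1)+\phi_2(v_2)$. An averaging operator on a commutative algebra $(A,\cdot_A)$ is a linear map $P:A\to A$ with $P(x)\cdot_A P(y)=P(P(x)\cdot_A y)$ for all $x,y$; then $(A,\cdot_A,P)$ is an averaging commutative algebra. $(A,\cdot_A,P,Q)$ is an admissible averaging commutative algebra if $(A,\cdot_A,P)$ is an averaging commutative algebra and $Q:A\to A$ is linear with $P(x)\cdot_A Q(y)=Q(P(x)\cdot_A y)=Q(x\cdot_A Q(y))$ for all $x,y\in A$. $\mathcal B_d$ is the bilinear form on $A\oplus A^*$ given by $\mathcal B_d(x+a^*,y+b^* )=\langle x,b^*\rangle+\langle a^*,y\rangle$. A bilinear form $\mathcal B$ on a commutative algebra is invariant if $\mathcal B(x\cdot y,z)=\mathcal B(x,y\cdot z)$. A double construction of Frobenius commutative algebra $\big((A\oplus A^*,\cdot_d,\mathcal B_d),(A,\cdot_A),(A^*,\cdot_{A^*})\big)$ consists of commutative algebras $(A,\cdot_A)$, $(A^*,\cdot_{A^*})$ and a commutative algebra structure $\cdot_d$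 on $A\oplus A^*$ containing $(A,\cdot_A)$ and $(A^*,\cdot_{A^*})$ as subalgebras such that $\mathcal B_d$ is invariant on $(A\oplus A^*,\cdot_d)$. If moreover $P$ is an averaging operator on $(A,\cdot_A)$, $Q^*$ is an averaging operator on $(A^*,\cdot_{A^*})$ and $P+Q^*$ is an averaging operator on $(A\oplus A^*,\cdot_d)$, then $\big((A\oplus A^*,\cdot_d,P+Q^*,\mathcal B_d),(A,\cdot_A,P),(A^*,\cdot_{A^*},Q^* )\big)$ is called a double construction of averaging Frobenius commutative algebra. The linear dual $\Delta$ of $\cdot_{A^*}$ is defined by $\langle\Delta(x),a^*\otimes b^*\rangle=\langle x,a^*\cdot_{A^*}b^*\rangle$. A commutative and cocommutative infinitesimal bialgebra is a triple $(A,\cdot_A,\Delta)$ where $(A,\cdot_A)$ is a commutative algebra, $\Delta=\tau\Delta$ ($\tau$ the flip), $(\Delta\otimes\mathrm{id})\Delta=(\mathrm{id}\otimes\Delta)\Delta$, and $\Delta(x\cdot_A y)=(\mathcal L_{\cdot_A}(x)\otimes\mathrm{id})\Delta(y)+(\mathrm{id}\otimes\mathcal L_{\cdot_A}(y))\Delta(x)$ for all $x,y$, where $\mathcal L_{\cdot_A}(x)y=x\cdot_A y$. It is a known fact that for commutative algebras $(A,\cdot_A)$, $(A^*,\cdot_{A^*})$, a double construction of Frobenius commutative algebra exists if and only if $(A,\cdot_A,\Delta)$ is such a bialgebra; this is the meaning of ''corresponding''. An averaging commutative and cocommutative infinitesimal bialgebra $(A,\cdot_A,\Delta,P,Q)$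 is a commutative and cocommutative infinitesimal bialgebra $(A,\cdot_A,\Delta)$ with linear maps $P,Q:A\to A$ such that $(A,\cdot_A,P,Q)$ is an admissible averaging commutative algebra and the two displayed lines of identities in (c) hold. *)

(* Defs.v *)
From HB Require Import structures.
From mathcomp Require Import all_boot all_order all_algebra.

Set Implicit Arguments.
Unset Strict Implicit.
Unset Printing Implicit Defensive.

Import GRing.Theory.
Local Open Scope ring_scope.

Section LinearAlgebra.
Variable K : fieldType.
Implicit Types U V W : vectType K.

Definition dual_space V : vectType K := 'Hom(V, K^o).

(* The value lies in K^o, which is convertible to K. *)
Definition pairing V (f : dual_space V) (v : V) : K := (f : 'Hom(V, K^o)) v.

Lemma pairingPl V (v : V) k (f g : dual_space V) :
  pairing (k *: f + g) v = k * pairing f v + pairing g v.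
Proof. by rewrite /pairing add_lfunE scale_lfunE. Qed.

Lemma pairingPr V (f : dual_space V) k (v w : V) :
  pairing f (k *: v + w) = k * pairing f v + pairing f w.
Proof. by rewrite /pairing linearP. Qed.

Definition precomp V (b : 'End(V)) (f : dual_space V) : dual_space V :=
  ((f : 'Hom(V, K^o)) \o b)%VF.

Fact precomp_is_linear V (b : 'End(V)) : linear (precomp b).
Proof. by move=> k f g; rewrite /precomp comp_lfunDl -comp_lfunZl. Qed.
HB.instance Definition _ V (b : 'End(V)) :=
  GRing.isLinear.Build K (dual_space V) (dual_space V) _ (precomp b) (precomp_is_linear b).

Definition transpose V (b : 'End(V)) : 'End(dual_space V) := linfun (precomp b).

Lemma transposeE V (b : 'End(V)) (f : dual_space V) (v : V) :
  pairing (transpose b f) v = pairing f (b v).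
Proof. by rewrite /pairing /transpose lfunE /= comp_lfunE. Qed.

Definition dsum_fun V W (f : 'End(V)) (g : 'End(W)) (u : V * W) : V * W :=
  (f u.1, g u.2).

Fact dsum_fun_is_linear V W (f : 'End(V)) (g : 'End(W)) :
  linear (dsum_fun f g).
Proof. by move=> k u v; rewrite /dsum_fun !linearP. Qed.
HB.instance Definition _ V W (f : 'End(V)) (g : 'End(W)) :=
  GRing.isLinear.Build K (V * W)%type (V * W)%type _ (dsum_fun f g)
    (dsum_fun_is_linear f g).

Definition dsum_map V W (f : 'End(V)) (g : 'End(W)) : 'End((V * W)%type) :=
  linfun (dsum_fun f g).

Lemma dsum_mapE V W (f : 'End(V)) (g : 'End(W)) (v : V) (w : W) :
  dsum_map f g (v, w) = (f v, g w).
Proof. by rewrite /dsum_map lfunE. Qed.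

(* An element of the tensor product of V and W is given by its coordinates on
   the products of the vectors of the library's bases of V and W.  All maps out
   of a tensor product are defined through its universal property, which is
   [tlift_tens] (existence) and [tens_ext] (uniqueness). *)
Definition tensor V W : vectType K := 'M[K]_(\dim {:V}, \dim {:W}).

Definition tens V W (v : V) (w : W) : tensor V W :=
  \matrix_(i, j) (coord (vbasis {:V}) i v * coord (vbasis {:W}) j w).

Definition tlift_fun V W U (f : V -> W -> U) (t : tensor V W) : U :=
  \sum_i \sum_j (t : 'M[K]_(_, _)) i j *: f (vbasis {:V})`_i (vbasis {:W})`_j.

Fact tlift_fun_is_linear V W U (f : V -> W -> U) : linear (tlift_fun f).
Proof.
move=> k s t; rewrite /tlift_fun scaler_sumr -big_split.
apply: eq_bigr => i _ /=.
rewrite scaler_sumr -big_split; apply: eq_bigr => j _ /=.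
by rewrite !mxE scalerDl scalerA.
Qed.
HB.instance Definition _ V W U (f : V -> W -> U) :=
  GRing.isLinear.Build K (tensor V W) U _ (tlift_fun f) (tlift_fun_is_linear f).

(* The linear map induced by f, meaningful when f is bilinear. *)
Definition tlift V W U (f : V -> W -> U) : 'Hom(tensor V W, U) :=
  linfun (tlift_fun f).

Fact tens_is_bilinear V W :
  bilinear_for *:%R *:%R (@tens V W : V -> W -> tensor V W).
Proof.
split=> [w|v] k x y; apply/matrixP => i j; rewrite !mxE linearP /=.
  by rewrite mulrDl mulrA.
by rewrite mulrDr mulrCA.
Qed.
HB.instance Definition _ V W :=
  bilinear_isBilinear.Build K V W (tensor V W) *:%R *:%R (@tens V W)
    (tens_is_bilinear V W).

Lemma tlift_tens V W U (f : V -> W -> U) (v : V) (w : W) :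
  bilinear_for *:%R *:%R f -> tlift f (tens v w) = f v w.
Proof.
move=> bf; suff tliftF (F : {bilinear V -> W -> U}) :
    tlift F (tens v w) = F v w.
  exact: (tliftF (HB.pack_for {bilinear V -> W -> U} f
    (bilinear_isBilinear.Build K V W U *:%R *:%R f bf))).
rewrite /tlift lfunE /= /tlift_fun.
rewrite [v in RHS](coord_vbasis (memvf v)) linear_sumlz.
apply: eq_bigr => i _.
rewrite [w in RHS](coord_vbasis (memvf w)) linear_sumr.
by apply: eq_bigr => j _; rewrite mxE linearZl_LR linearZr_LR scalerA mulrC.
Qed.

Lemma tens_ext V W U (f g : 'Hom(tensor V W, U)) :
  (forall v w, f (tens v w) = g (tens v w)) -> f = g.
Proof.
move=> fg; apply/lfunP => t.
have -> : t = \sum_i \sum_j (t : 'M[K]_(_, _)) i j *: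
    tens (vbasis {:V})`_i (vbasis {:W})`_j.
  rewrite [LHS]matrix_sum_delta; apply: eq_bigr => i _; apply: eq_bigr => j _.
  congr (_ *: _); apply/matrixP => a b.
  have fV := basis_free (vbasisP {:V}); have fW := basis_free (vbasisP {:W}).
  by rewrite !mxE !coord_free // -natrM mulnb (eq_sym i) (eq_sym j).
rewrite !linear_sum; apply: eq_bigr => i _; rewrite !linear_sum.
by apply: eq_bigr => j _; rewrite [LHS]linearZ [RHS]linearZ /= fg.
Qed.

Definition tensor_map V W V' W' (f : 'Hom(V, V')) (g : 'Hom(W, W')) :
    'Hom(tensor V W, tensor V' W') :=
  tlift (fun v w => tens (f v) (g w)).

Definition flip V W : 'Hom(tensor V W, tensor W V) :=
  tlift (fun v w => tens w v).

Definition tassoc U V W :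
    'Hom(tensor (tensor U V) W, tensor U (tensor V W)) :=
  tlift (fun t w => tlift (fun u v => tens u (tens v w)) t).

Definition tens_pairing V W (t : tensor V W) (s : tensor (dual_space V) (dual_space W)) : K :=
  tlift (fun f g => tlift (fun v w => pairing f v * pairing g w : K^o) t) s.

Lemma tensor_mapE V W V' W' (f : 'Hom(V, V')) (g : 'Hom(W, W')) v w :
  tensor_map f g (tens v w) = tens (f v) (g w).
Proof.
by rewrite /tensor_map tlift_tens //; split=> [y|x] k a b;
  rewrite linearP /= (linearPl, linearPr).
Qed.

Lemma flipE V W (v : V) (w : W) : flip V W (tens v w) = tens w v.
Proof.
by rewrite /flip tlift_tens //; split=> [y|x] k a b; rewrite (linearPr, linearPl).
Qed.

Lemma tassocE U V W (u : U) (v : V) (w : W) :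
  tassoc U V W (tens (tens u v) w) = tens u (tens v w).
Proof.
have tE w' : tlift (fun u v => tens u (tens v w')) (tens u v) =
    tens u (tens v w') :> tensor U (tensor V W).
  by rewrite tlift_tens //; split=> [y|x] k a b; rewrite ?linearPl ?linearPr.
rewrite /tassoc tlift_tens //; split=> [y|x] k a b; first by rewrite linearP.
rewrite /tlift !lfunE /= /tlift_fun scaler_sumr -big_split.
apply: eq_bigr => i _ /=; rewrite scaler_sumr -big_split.
apply: eq_bigr => j _ /=.
by rewrite !linearPr scalerDr !scalerA mulrC.
Qed.

Lemma tens_pairing_tens V W (t : tensor V W) (f : dual_space V)
    (g : dual_space W) :
  tens_pairing t (tens f g) =
  tlift (fun v w => pairing f v * pairing g w : K^o) t.
Proof.
rewrite /tens_pairing tlift_tens //; split=> [y|x] k a b;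
  rewrite /tlift !lfunE /= /tlift_fun scaler_sumr -big_split;
  apply: eq_bigr => i _ /=; rewrite scaler_sumr -big_split;
  apply: eq_bigr => j _ /=; rewrite pairingPl /GRing.scale /=.
  by rewrite mulrDl mulrDr -mulrA mulrCA.
by rewrite !mulrDr (mulrCA (pairing x _)) (mulrCA _ k).
Qed.

Lemma tens_pairingE V W (v : V) (w : W) (f : dual_space V) (g : dual_space W) :
  tens_pairing (tens v w) (tens f g) = pairing f v * pairing g w.
Proof.
rewrite tens_pairing_tens tlift_tens //; split=> [y|x] k a b; rewrite pairingPr.
  by rewrite mulrDl -mulrA.
by rewrite mulrDr mulrCA.
Qed.

End LinearAlgebra.

Section Algebra.
Variable K : fieldType.
Implicit Types A : vectType K.

Record comm_algebra A := CommAlg {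
  alg_mul :> {bilinear A -> A -> A};
  alg_mulC : commutative alg_mul;
  alg_mulA : associative alg_mul }.

Definition averaging A (mA : comm_algebra A) (P : 'End(A)) :=
  forall x y, mA (P x) (P y) = P (mA (P x) y).

Definition admissible_averaging A (mA : comm_algebra A) (P Q : 'End(A)) :=
  averaging mA P /\
  forall x y, mA (P x) (Q y) = Q (mA (P x) y) /\
              Q (mA (P x) y) = Q (mA x (Q y)).

Definition invariant_form A (mA : comm_algebra A) (B : A -> A -> K) :=
  forall x y z, B (mA x y) z = B x (mA y z).

Definition double_space A : vectType K := (A * dual_space A)%type.

Definition Bd A (u v : double_space A) : K := pairing v.2 u.1 + pairing u.2 v.1.

Definition double_frobenius A (md : comm_algebra (double_space A)) (mA : comm_algebra A)
    (mAs : comm_algebra (dual_space A)) :=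
  [/\ forall x y : A, md (x, 0) (y, 0) = (mA x y, 0),
      forall a b : dual_space A, md (0, a) (0, b) = (0, mAs a b)
    & invariant_form md (@Bd A)].

Definition double_averaging_frobenius A (md : comm_algebra (double_space A))
    (mA : comm_algebra A) (mAs : comm_algebra (dual_space A)) (P Q : 'End(A)) :=
  [/\ double_frobenius md mA mAs,
      averaging mA P,
      averaging mAs (transpose Q)
    & averaging md (dsum_map P (transpose Q))].

Definition linear_dual A (mAs : comm_algebra (dual_space A))
    (Delta : 'Hom(A, tensor A A)) :=
  forall (x : A) (a b : dual_space A),
    tens_pairing (Delta x) (tens a b) = pairing (mAs a b) x.

Lemma linear_dual_exists A (mAs : comm_algebra (dual_space A)) :
  exists Delta, linear_dual mAs Delta.
Proof.
pose c i : {linear A -> K^o} := coord (vbasis {:A}) i.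
pose e i : dual_space A := linfun (c i).
have dualE (f : dual_space A) :
    f = \sum_(i < \dim {:A}) pairing f (vbasis {:A})`_i *: e i.
  apply/lfunP => v; rewrite sum_lfunE [in LHS](coord_vbasis (memvf v)).
  rewrite linear_sum; apply: eq_bigr => i _.
  by rewrite scale_lfunE linearZ /= lfunE /GRing.scale /= mulrC.
pose D (x : A) : tensor A A := \matrix_(i, j) pairing (mAs (e i) (e j)) x.
have linD : linear D.
  by move=> k x y; apply/matrixP => i j; rewrite !mxE pairingPr.
pose F : {linear A -> tensor A A} :=
  HB.pack_for {linear A -> tensor A A} D
    (GRing.isLinear.Build K A (tensor A A) *:%R D linD).
exists (linfun F) => x a b; rewrite lfunE /= tens_pairing_tens /tlift lfunE /=.
rewrite /tlift_fun [in RHS](dualE a) linear_sumlz /pairing sum_lfunE.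
apply: eq_bigr => i _; rewrite [in RHS](dualE b) linear_sumr sum_lfunE.
apply: eq_bigr => j _.
by rewrite mxE linearZl_LR linearZr_LR !scale_lfunE /GRing.scale /= mulrC mulrA.
Qed.

Definition lmul A (mA : comm_algebra A) (x : A) : 'End(A) := linfun (mA x).

Local Notation "f ⊗ g" := (tensor_map f g) (at level 35).

Definition cc_inf_bialgebra A (mA : comm_algebra A) (Delta : 'Hom(A, tensor A A)) :=
  [/\ forall x, flip A A (Delta x) = Delta x,
      forall x, tassoc A A A ((Delta ⊗ \1) (Delta x)) = (\1 ⊗ Delta) (Delta x)
    & forall x y, Delta (mA x y) =
        (lmul mA x ⊗ \1) (Delta y) + (\1 ⊗ lmul mA y) (Delta x)].

Definition averaging_cc_inf_bialgebra A (mA : comm_algebra A)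
    (Delta : 'Hom(A, tensor A A)) (P Q : 'End(A)) :=
  [/\ cc_inf_bialgebra mA Delta,
      admissible_averaging mA P Q,
      forall x, (Q ⊗ Q) (Delta x) = (Q ⊗ \1) (Delta (Q x))
    & forall x, (Q ⊗ P) (Delta x) = (Q ⊗ \1) (Delta (P x)) /\
                (Q ⊗ \1) (Delta (P x)) = (\1 ⊗ P) (Delta (P x))].

End Algebra.

(* Main.v *)
Require Import Defs.
From HB Require Import structures.
From mathcomp Require Import all_boot all_order all_algebra.
Import GRing.Theory.

Set Implicit Arguments.
Unset Strict Implicit.
Unset Printing Implicit Defensive.

Local Open Scope ring_scope.

(** The equivalence rests on one observation about a commutative algebra with an
    invariant form B and an endomorphism M with adjoint N.  The averaging defect
    B(M u . M v - M (M u . v), w) can be moved, by invariance and adjunction,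
    onto any of its arguments: it equals both
    B(v, N (M u . w) - M u . N w) and B(u, N (M v . w) - N (v . N w))
    ([averaging_at2], [averaging_at1]).  So, when B is nondegenerate, M is
    averaging exactly when the pair (M, N) is admissible.

    Write ' for duals and transposes.  In the double A + A', the adjoint of
    M = P + Q' is N = Q + P'.  If M is averaging then (M, N) is admissible, and
    restricting to the two summands gives admissibility of (P, Q) on A and of
    (Q', P') on A'
    ([admissible_double_restrict]).  Conversely the defect is trilinear, hence
    determined by arguments that each lie in a summand; two of the three then lie
    in the same summand, and admissibility there kills the defect, whatever the
    third argument is ([averaging_double_of_admissible]).

    The passage between A' and the coproduct Delta is by duality: a tensor is
    determined by its values under the functionals f (x) g ([tensor_eq]), and
    under such a functional (b (x) c) Delta(x) becomes the value at x of
    b'(f) . c'(g) ([tens_fun_map_Delta]).  The identities for A' are therefore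
    the transposes of those for Delta ([averaging_dual_iff],
    [admissible_dual_iff]).  The bialgebra axioms are translated in the same
    way; the compatibility of Delta with the product comes from the
    associativity of the double and the invariance of its form ([dual_mul_compat]). *)

(** * Functionals on tensor products *)

Section TensorDuality.
Context {K : fieldType}.
Implicit Types U V W : vectType K.

Lemma dual_separates V (v w : V) :
  (forall f : dual_space V, pairing f v = pairing f w) -> v = w.
Proof.
move=> vw; rewrite (coord_vbasis (memvf v)) (coord_vbasis (memvf w)).
apply: eq_bigr => i _; congr (_ *: _).
have := vw (linfun (coord (vbasis {:V}) i : {linear V -> K^o})).
by rewrite /pairing !lfunE.
Qed.

Lemma dual_ext V (f g : dual_space V) :
  (forall v, pairing f v = pairing g v) -> f = g.
Proof. by move=> fg; apply/lfunP => v; apply: fg. Qed.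

Lemma pairingD V (f : dual_space V) v w :
  pairing f (v + w) = pairing f v + pairing f w.
Proof. by rewrite /pairing linearD. Qed.

(** The functional f (x) g on the tensor product. *)
Definition tens_fun V W (f : dual_space V) (g : dual_space W) :
    dual_space (tensor V W) :=
  tlift (fun v w => pairing f v * pairing g w : K^o).

Lemma tens_funE V W (f : dual_space V) (g : dual_space W) v w :
  pairing (tens_fun f g) (tens v w) = pairing f v * pairing g w.
Proof. by rewrite -tens_pairingE tens_pairing_tens. Qed.

Lemma tens_fun_map V W V' W' (b : 'Hom(V, V')) (c : 'Hom(W, W'))
    (f : dual_space V') (g : dual_space W') t :
  pairing (tens_fun f g) (tensor_map b c t) =
  pairing (tens_fun ((f : 'Hom(V', K^o)) \o b)%VF
                    ((g : 'Hom(W', K^o)) \o c)%VF) t.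
Proof.
set h := (X in _ = pairing X _).
suff <- : ((tens_fun f g : 'Hom(_, K^o)) \o tensor_map b c)%VF = h
  by rewrite /pairing comp_lfunE.
apply: tens_ext => v w; rewrite comp_lfunE tensor_mapE.
by rewrite -!/(pairing _ _) !tens_funE /pairing !comp_lfunE.
Qed.

Lemma tens_fun_flip V W (f : dual_space V) (g : dual_space W) t :
  pairing (tens_fun g f) (flip V W t) = pairing (tens_fun f g) t.
Proof.
suff <- : ((tens_fun g f : 'Hom(_, K^o)) \o flip V W)%VF = tens_fun f g
  by rewrite /pairing comp_lfunE.
apply: tens_ext => v w; rewrite comp_lfunE flipE.
by rewrite -!/(pairing _ _) !tens_funE mulrC.
Qed.

Lemma tens_fun_assoc U V W (f : dual_space U) (g : dual_space V)
    (h : dual_space W) t :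
  pairing (tens_fun f (tens_fun g h)) (tassoc U V W t) =
  pairing (tens_fun (tens_fun f g) h) t.
Proof.
pose F := ((tens_fun f (tens_fun g h) : 'Hom(_, K^o)) \o tassoc U V W)%VF.
suff FE s w : F (tens s w) = pairing (tens_fun (tens_fun f g) h) (tens s w).
  have <- : F = tens_fun (tens_fun f g) h by apply: tens_ext.
  by rewrite /pairing comp_lfunE.
(* For fixed w, both sides are linear in s, so that uniqueness on the inner
   tensor product applies once tens - w is bundled as a linear map. *)
have linG : linear (fun s => tens s w : tensor (tensor U V) W).
  by move=> k a b; rewrite linearPl.
pose G : {linear tensor U V -> tensor (tensor U V) W} :=
  HB.pack (fun s => tens s w : tensor (tensor U V) W)
  (GRing.isLinear.Build K (tensor U V) (tensor (tensor U V) W) *:%R _ linG).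
pose L := linfun G; have LE r : L r = tens r w by rewrite lfunE.
rewrite -!LE.
suff /lfunP/(_ s) : (F \o L)%VF =
    ((tens_fun (tens_fun f g) h : 'Hom(_, K^o)) \o L)%VF by rewrite !comp_lfunE.
apply: tens_ext => u v; rewrite !comp_lfunE !LE tassocE.
by rewrite -!/(pairing _ _) !tens_funE mulrA.
Qed.

Definition separating V (F : dual_space V -> Prop) :=
  forall v, (forall f, F f -> pairing f v = 0) -> v = 0.

Lemma separating_all V : separating (fun _ : dual_space V => True).
Proof.
move=> v v0; apply: dual_separates => f.
by rewrite v0 // /pairing linear0.
Qed.

(** Stated for families of functionals, not for the whole duals, so that it can be
    iterated: on a triple tensor product the functionals f (x) (g (x) h) are
    only a part of those of the form f (x) k.  Contract t with g in G on the
    second factor: the result in V is killed by F, so it is zero, and hence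
    f (x) g kills t for every f in the dual of V and g in G.  Contract next with an
    arbitrary f on the first factor: the result in W is killed by G, so it is
    zero, and f (x) g kills t for all f and g.  The entries of t are such
    values. *)
Lemma separating_tens V W (F : dual_space V -> Prop) (G : dual_space W -> Prop) :
  separating F -> separating G ->
  separating (fun h => exists f g, [/\ F f, G g & h = tens_fun f g]).
Proof.
move=> sepF sepG t t0.
pose fst_part (g : dual_space W) : 'Hom(tensor V W, V) :=
  tlift (fun v w => pairing g w *: v).
pose snd_part (f : dual_space V) : 'Hom(tensor V W, W) :=
  tlift (fun v w => pairing f v *: w).
have fst_partE f g : pairing f (fst_part g t) = pairing (tens_fun f g) t.
  suff <- : ((f : 'Hom(V, K^o)) \o fst_part g)%VF = tens_fun f g
    by rewrite /pairing comp_lfunE.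
  apply: tens_ext => v w; rewrite comp_lfunE -/(pairing (tens_fun f g) _).
  rewrite tens_funE /fst_part tlift_tens; first by rewrite linearZ mulrC.
  split=> [y|y] k a b /=; first by rewrite scalerDr !scalerA mulrC.
  by rewrite pairingPr scalerDl scalerA.
have snd_partE f g : pairing g (snd_part f t) = pairing (tens_fun f g) t.
  suff <- : ((g : 'Hom(W, K^o)) \o snd_part f)%VF = tens_fun f g
    by rewrite /pairing comp_lfunE.
  apply: tens_ext => v w; rewrite comp_lfunE -/(pairing (tens_fun f g) _).
  rewrite tens_funE /snd_part tlift_tens; first by rewrite linearZ.
  split=> [y|y] k a b /=; last by rewrite scalerDr !scalerA mulrC.
  by rewrite pairingPr scalerDl scalerA.
have fst0 g : G g -> fst_part g t = 0.
  by move=> Gg; apply: sepF => f Ff; rewrite fst_partE t0 //; exists f, g.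
have snd0 f : snd_part f t = 0.
  apply: sepG => g Gg; rewrite snd_partE -fst_partE fst0 //.
  by rewrite /pairing linear0.
apply/matrixP => i j; rewrite [RHS]mxE.
(* The (i, j) entry of t is its value under the product of the coordinate forms. *)
pose c (X : vectType K) k : dual_space X :=
  linfun (coord (vbasis {:X}) k : {linear X -> K^o}).
have <- : pairing (tens_fun (c V i) (c W j)) t = t i j.
  have entry_linear : linear (fun s : tensor V W => (s : 'M[K]_(_, _)) i j : K^o).
    by move=> k a b; rewrite !mxE.
  pose ev : {linear tensor V W -> K^o} := HB.pack
    (fun s : tensor V W => (s : 'M[K]_(_, _)) i j : K^o)
    (GRing.isLinear.Build K (tensor V W) K^o *:%R _ entry_linear).
  suff -> : tens_fun (c V i) (c W j) = linfun ev by rewrite /pairing lfunE.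
  apply: tens_ext => v w; rewrite -!/(pairing _ _) tens_funE /pairing !lfunE.
  by rewrite /= mxE.
by rewrite -snd_partE snd0 /pairing linear0.
Qed.

Lemma separating_eq V (F : dual_space V -> Prop) v w :
  separating F -> (forall f, F f -> pairing f v = pairing f w) -> v = w.
Proof.
move=> sepF vw; apply/eqP; rewrite -subr_eq0; apply/eqP; apply: sepF => f Ff.
by rewrite [LHS]linearB; apply/eqP; rewrite subr_eq0; apply/eqP/vw.
Qed.

Lemma tensor_eq V W (s t : tensor V W) :
  (forall f g, pairing (tens_fun f g) s = pairing (tens_fun f g) t) -> s = t.
Proof.
move=> st; apply: (separating_eq (separating_tens (@separating_all V)
  (@separating_all W))) => _ [f [g [_ _ ->]]]; exact: st.
Qed.

End TensorDuality.

(** * Averaging operators and their adjoints for an invariant form *)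

Section FrobeniusAdjoint.
Context {K : fieldType} {V : vectType K} (m : comm_algebra V) (B : V -> V -> K).
Context (M N : 'End(V)).
Hypothesis (Binv : invariant_form m B).
Hypothesis adj : forall u v, B (M u) v = B u (N v).

(** The averaging identity tested at a single triple of vectors, because the
    argument on the double takes two of the three in one summand and leaves the
    third arbitrary. *)
Definition averaging_at u v w := B (m (M u) (M v)) w = B (M (m (M u) v)) w.

(** Each side of the averaging identity is rewritten so that a chosen argument
    stands alone in the form: invariance carries the other factor of a product
    across, and adjunction turns M into N. *)
Lemma form_mulM u v w : B (m (M u) (M v)) w = B v (N (m (M u) w)).
Proof. by rewrite (alg_mulC m (M u)) Binv adj. Qed.

Lemma form_Mmul2 u v w : B (M (m (M u) v)) w = B v (m (M u) (N w)).
Proof. by rewrite adj (alg_mulC m (M u)) Binv. Qed.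

Lemma form_Mmul1 u v w : B (M (m (M u) v)) w = B u (N (m v (N w))).
Proof. by rewrite adj Binv adj. Qed.

Lemma averaging_at2 u v w :
  averaging_at u v w <-> B v (m (M u) (N w)) = B v (N (m (M u) w)).
Proof. by rewrite /averaging_at form_mulM form_Mmul2; split. Qed.

Lemma averaging_at1 u v w :
  averaging_at u v w <-> B u (N (m (M v) w)) = B u (N (m v (N w))).
Proof.
rewrite /averaging_at (alg_mulC m (M u)) form_mulM form_Mmul1.
by split.
Qed.

(** Both admissibility identities are the averaging identity of M, with the
    defect moved onto its second or its first argument. *)
Lemma admissible_of_averaging :
  (forall u v, (forall w, B w u = B w v) -> u = v) ->
  averaging m M -> admissible_averaging m M N.
Proof.
move=> Bnd avgM; split=> // x y.
have at3 u v w : averaging_at u v w by rewrite /averaging_at avgM.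
by split; apply: Bnd => w; [apply/averaging_at2|apply/averaging_at1].
Qed.

(** The positions of the two vectors of S among the three arguments correspond to
    the three admissibility identities, one each: moving the defect so that the
    remaining vector w stands alone in the form leaves an identity between
    products of elements of S against w. *)
Lemma averaging_at_two_of_three (S : V -> Prop) :
  (forall u v, S u -> S v -> [/\ m (M u) (M v) = M (m (M u) v),
     m (M u) (N v) = N (m (M u) v) & N (m (M u) v) = N (m u (N v))]) ->
  forall u v w, S u -> S v ->
  [/\ averaging_at u v w, averaging_at u w v & averaging_at w u v].
Proof.
move=> admS u v w Su Sv; have [e1 e2 e3] := admS _ _ Su Sv.
split; first by rewrite /averaging_at e1.
  by apply/averaging_at2; rewrite e2.
by apply/averaging_at1; rewrite e3.
Qed.

End FrobeniusAdjoint.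

(** * The double A + A' *)

Section DoubleConstruction.
Context {K : fieldType} {A : vectType K}.
Implicit Types (P Q : 'End(A)).

Lemma BdC (u v : double_space A) : Bd u v = Bd v u.
Proof. by rewrite /Bd addrC. Qed.

Lemma BdDl (u v w : double_space A) : Bd (u + v) w = Bd u w + Bd v w.
Proof. by rewrite /Bd /pairing add_lfunE linearD addrACA. Qed.

Lemma Bd_inl (x : A) v : Bd (x, 0) v = pairing v.2 x.
Proof. by rewrite /Bd /pairing /= zero_lfunE addr0. Qed.

Lemma Bd_inr (a : dual_space A) v : Bd (0, a) v = pairing a v.1.
Proof. by rewrite /Bd /pairing /= linear0 add0r. Qed.

Lemma Bd_nondegenerate (u v : double_space A) :
  (forall w, Bd w u = Bd w v) -> u = v.
Proof.
case: u v => [x a] [y b] uv; congr pair.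
  by apply: dual_separates => f; have := uv (0, f); rewrite !Bd_inr.
by apply: dual_ext => z; have := uv (z, 0); rewrite !Bd_inl.
Qed.

Lemma Bd_adjoint P Q (u v : double_space A) :
  Bd (dsum_map P (transpose Q) u) v = Bd u (dsum_map Q (transpose P) v).
Proof. by case: u v => [x a] [y b]; rewrite !dsum_mapE /Bd /= !transposeE. Qed.

Context {mA : comm_algebra A} {mAs : comm_algebra (dual_space A)}.
Context {md : comm_algebra (double_space A)} (hd : double_frobenius md mA mAs).

Lemma admissible_double_restrict P Q :
  admissible_averaging md (dsum_map P (transpose Q)) (dsum_map Q (transpose P)) ->
  admissible_averaging mA P Q /\
  admissible_averaging mAs (transpose Q) (transpose P).
Proof.
case: hd => mdA mdAs _ [avgM admN]; split; split=> x y.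
- by have := avgM (x, 0) (y, 0); rewrite !(dsum_mapE, linear0, mdA) => -[].
- by have := admN (x, 0) (y, 0); rewrite !(dsum_mapE, linear0, mdA) => -[[->] [->]].
- by have := avgM (0, x) (0, y); rewrite !(dsum_mapE, linear0, mdAs) => -[].
- by have := admN (0, x) (0, y); rewrite !(dsum_mapE, linear0, mdAs) => -[[->] [->]].
Qed.

(** Pigeonhole: split each of the three arguments of the defect into its
    components in A and A'; in each of the eight terms two arguments lie in the
    same summand. *)
Lemma averaging_double_of_admissible P Q :
  admissible_averaging mA P Q ->
  admissible_averaging mAs (transpose Q) (transpose P) ->
  averaging md (dsum_map P (transpose Q)).
Proof.
case: hd => mdA mdAs inv [avgP admPQ] [avgQ admQP].
pose M := dsum_map P (transpose Q).
pose at_ := averaging_at md (@Bd K A) M.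
have at3 := averaging_at_two_of_three inv (Bd_adjoint P Q).
have at3A x y w : [/\ at_ (x, 0) (y, 0) w, at_ (x, 0) w (y, 0)
                    & at_ w (x, 0) (y, 0)].
  apply: (at3 (fun u => exists x, u = (x, 0))); [|by exists x|by exists y].
  move=> _ _ [z ->] [t ->]; rewrite !(dsum_mapE, linear0, mdA).
  by rewrite avgP; have [-> ->] := admPQ z t.
have at3As a b w : [/\ at_ (0, a) (0, b) w, at_ (0, a) w (0, b)
                     & at_ w (0, a) (0, b)].
  apply: (at3 (fun u => exists a, u = (0, a))); [|by exists a|by exists b].
  move=> _ _ [z ->] [t ->]; rewrite !(dsum_mapE, linear0, mdAs).
  by rewrite avgQ; have [-> ->] := admQP z t.
have addu u u' v w : at_ u v w -> at_ u' v w -> at_ (u + u') v w.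
  by rewrite /at_ /averaging_at !(linearD, linearDl) /= !BdDl => -> ->.
have addv u v v' w : at_ u v w -> at_ u v' w -> at_ u (v + v') w.
  by rewrite /at_ /averaging_at !(linearD, linearDr) /= !BdDl => -> ->.
have addw u v w w' : at_ u v w -> at_ u v w' -> at_ u v (w + w').
  by rewrite /at_ /averaging_at ![Bd _ (_ + _)]BdC !BdDl ![Bd _ (md _ _)]BdC
     ![Bd _ (M _)]BdC => -> ->.
have splitE (u : double_space A) : u = (u.1, 0) + (0, u.2).
  by case: u => x a; congr pair; rewrite /= (addr0, add0r).
move=> u v; apply: Bd_nondegenerate => w; rewrite ![Bd w _]BdC -/M.
change (at_ u v w); rewrite (splitE u) (splitE v) (splitE w).
apply: addu; apply: addv; apply: addw;
  by [case: (at3A u.1 v.1 (w.1, 0)) | case: (at3A u.1 v.1 (0, w.2))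
     |case: (at3A u.1 w.1 (0, v.2)) | case: (at3A v.1 w.1 (0, u.2))
     |case: (at3As u.2 v.2 (w.1, 0)) | case: (at3As u.2 v.2 (0, w.2))
     |case: (at3As u.2 w.2 (v.1, 0)) | case: (at3As v.2 w.2 (u.1, 0))].
Qed.

(** Invariance forces the mixed products: the A' component of x . b is the
    coadjoint action of x on b, and its A component is the coadjoint action of
    b on x. *)
Lemma double_mul_mixed_dual x b :
  (md (x, 0) (0, b)).2 = transpose (lmul mA x) b.
Proof.
case: hd => mdA _ inv; apply: dual_ext => y; rewrite transposeE lfunE /=.
by rewrite -Bd_inl BdC (alg_mulC md) inv mdA Bd_inr.
Qed.

Lemma double_mul_mixed x b a :
  pairing a (md (x, 0) (0, b)).1 = pairing (mAs b a) x.
Proof.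
case: hd => _ mdAs inv.
by rewrite -Bd_inr BdC inv mdAs Bd_inl.
Qed.

(** This is the compatibility of the coproduct with the product, read on A'.  Expand
    B(b . (x . a), y): associativity and invariance turn it into the left-hand
    side, and splitting x . a into its two components gives the two terms on
    the right. *)
Lemma dual_mul_compat a b x y :
  pairing (mAs a b) (mA x y) =
  pairing (mAs (transpose (lmul mA x) a) b) y +
  pairing (mAs a (transpose (lmul mA y) b)) x.
Proof.
have [mdA mdAs inv] := hd.
have -> : pairing (mAs a b) (mA x y) = Bd (md (0, b) (md (x, 0) (0, a))) (y, 0).
  rewrite (alg_mulC md (x, 0)) (alg_mulA md) mdAs inv mdA Bd_inr.
  by rewrite (alg_mulC mAs).
have -> : md (x, 0) (0, a) =
    ((md (x, 0) (0, a)).1, 0) + (0, transpose (lmul mA x) a).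
  rewrite -double_mul_mixed_dual; case: (md _ _) => u c.
  by congr pair; rewrite /= (addr0, add0r).
rewrite linearDr BdDl mdAs Bd_inr (alg_mulC mAs b) addrC; congr (_ + _).
rewrite (alg_mulC md) BdC Bd_inl double_mul_mixed_dual transposeE lfunE /=.
rewrite (alg_mulC mA) -[mA y _]lfunE -/(lmul mA y) -transposeE.
by rewrite double_mul_mixed.
Qed.

(** * Transposing identities from A' to the coproduct *)

Context {Delta : 'Hom(A, tensor A A)} (hDelta : linear_dual mAs Delta).

Lemma tens_fun_Delta a b x :
  pairing (tens_fun a b) (Delta x) = pairing (mAs a b) x.
Proof. by rewrite -hDelta tens_pairing_tens. Qed.

(** The dictionary between Delta and the product of A': every identity on Delta is
    tested against f (x) g with this formula. *)
Lemma tens_fun_map_Delta (f g : 'End(A)) a b x :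
  pairing (tens_fun a b) (tensor_map f g (Delta x)) =
  pairing (mAs (transpose f a) (transpose g b)) x.
Proof. by rewrite tens_fun_map -tens_fun_Delta /transpose !lfunE. Qed.

Lemma transpose1 : transpose (\1%VF : 'End(A)) = \1%VF.
Proof.
by apply/lfunP => a; apply: dual_ext => x; rewrite transposeE !id_lfunE.
Qed.

(** Cocommutativity and coassociativity are the transposes of the laws of A', and
    the compatibility condition is the transpose of [dual_mul_compat]. *)
Lemma double_frobenius_bialgebra : cc_inf_bialgebra mA Delta.
Proof.
split=> [x|x|x y].
- apply: tensor_eq => a b.
  by rewrite tens_fun_flip !tens_fun_Delta (alg_mulC mAs).
- apply: (separating_eq (separating_tens (@separating_all _ _)
    (separating_tens (@separating_all _ _) (@separating_all _ _)))).
  move=> _ [a [_ [_ [b [c [_ _ ->]]] ->]]].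
  have comp_Delta f g : (tens_fun f g \o Delta)%VF = mAs f g.
    by apply/lfunP => z; rewrite comp_lfunE; apply: tens_fun_Delta.
  rewrite tens_fun_assoc !tens_fun_map !comp_Delta.
  by rewrite !comp_lfun1r !tens_fun_Delta (alg_mulA mAs).
- apply: tensor_eq => a b; rewrite pairingD tens_fun_Delta.
  rewrite !tens_fun_map_Delta transpose1 !id_lfunE.
  exact: dual_mul_compat.
Qed.

Lemma averaging_dual_iff Q :
  averaging mAs (transpose Q) <->
  forall x, tensor_map Q Q (Delta x) = tensor_map Q \1%VF (Delta (Q x)).
Proof.
split=> [avgQ x | DQ a b].
  apply: tensor_eq => a b; rewrite !tens_fun_map_Delta transpose1 id_lfunE.
  by rewrite avgQ transposeE.
apply: dual_ext => x; have := congr1 (pairing (tens_fun a b)) (DQ x).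
by rewrite !tens_fun_map_Delta transpose1 id_lfunE transposeE.
Qed.

Lemma admissible_dual_iff P Q :
  (forall a b, mAs (transpose Q a) (transpose P b) =
                 transpose P (mAs (transpose Q a) b) /\
               transpose P (mAs (transpose Q a) b) =
                 transpose P (mAs a (transpose P b))) <->
  forall x, tensor_map Q P (Delta x) = tensor_map Q \1%VF (Delta (P x)) /\
    tensor_map Q \1%VF (Delta (P x)) = tensor_map \1%VF P (Delta (P x)).
Proof.
split=> [adm x | DP a b].
  split; apply: tensor_eq => a b; have [e1 e2] := adm a b;
    rewrite !tens_fun_map_Delta transpose1 !id_lfunE.
    by rewrite e1 transposeE.
  by rewrite -!(transposeE P) e2.
split; apply: dual_ext => x; have [e1 e2] := DP x.
  have := congr1 (pairing (tens_fun a b)) e1.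
  by rewrite !tens_fun_map_Delta transpose1 id_lfunE transposeE.
have := congr1 (pairing (tens_fun a b)) e2.
by rewrite !tens_fun_map_Delta transpose1 !id_lfunE !transposeE.
Qed.

End DoubleConstruction.

Theorem theorem2p16 (K : closedFieldType) (charK0 : [pchar K] =i pred0)
    (A : vectType K) (mA : comm_algebra A) (mAs : comm_algebra (dual_space A))
    (md : comm_algebra (double_space A)) (hd : double_frobenius md mA mAs)
    (Delta : 'Hom(A, tensor A A)) (hDelta : linear_dual mAs Delta)
    (P Q : 'End(A)) :
  [<-> double_averaging_frobenius md mA mAs P Q;
       admissible_averaging mA P Q /\
         admissible_averaging mAs (transpose Q) (transpose P);
       averaging_cc_inf_bialgebra mA Delta P Q].
Proof.
tfae.
- move=> [_ _ _ avgM]; apply: (admissible_double_restrict hd).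
  have [_ _ inv] := hd.
  exact: (admissible_of_averaging inv (Bd_adjoint P Q)
    (@Bd_nondegenerate _ _)).
- move=> [admA [avgQ admAs]]; split=> //.
  + exact: (double_frobenius_bialgebra hd hDelta).
  + exact/(averaging_dual_iff hDelta).
  + exact/(admissible_dual_iff hDelta).
- move=> [_ admA /(averaging_dual_iff hDelta) avgQ
           /(admissible_dual_iff hDelta) admAs].
  have [avgP _] := admA; split=> //.
  exact: (averaging_double_of_admissible hd).
Qed.
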